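(* If $A\subset [0,\infty)$ and $0\in A$, then there exists a Bernstein set $X\subset \mathbb{R}$ such that $S(X)=A$.
   Context: For a metric space $(X,d)$, the center of distances of $X$ is the set $S(X):=\{a\in[0,\infty) : \forall x\in X\ \exists y\in X\ d(x,y)=a\}$. Subsets $X\subset\mathbb{R}$ are considered with the usual metric $d(x,y)=|x-y|$. A Bernstein set (on the real line) is a subset $B\subset\mathbb{R}$ such that both $B$ and its complement $\mathbb{R}\setminus B$ meet every uncountable closed subset of $\mathbb{R}$. *)

(* Defs.v *)
From mathcomp Require Import all_boot all_order all_algebra.
From mathcomp Require Import all_classical all_reals all_analysis.

Set Implicit Arguments.
Unset Strict Implicit.
Unset Printing Implicit Defensive.

Import Order.TTheory GRing.Theory Num.Theory numFieldNormedType.Exports.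
Local Open Scope classical_set_scope.
Local Open Scope ring_scope.

(* The metric space is the subspace [X] of an ambient metric space [T], with the
   restricted distance; a whole space is the case [X = setT]. *)
Definition center_of_distances (R : realType) (T : metricType R) (X : set T) :
    set R :=
  [set a | 0 <= a /\ forall x, X x -> exists2 y, X y & mdist x y = a].

(* The library puts the usual metric of the real line on the alias [R^o] of [R]
   only, hence [T := R^o] for subsets of the line. *)
Lemma center_of_distances_realE (R : realType) (X : set R) :
  center_of_distances (T := R^o) X =
  [set a | 0 <= a /\ forall x, X x -> exists2 y, X y & `|x - y| = a].
Proof.
apply/seteqP; split=> a [a0 h]; split=> // x /h[y Xy <-];
  by exists y; rewrite // distrC.
Qed.

Definition bernstein_set (R : realType) (B : set R) : Prop :=
  forall F : set R, closed F -> ~ countable F ->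
    B `&` F !=set0 /\ ~` B `&` F !=set0.

(* Main.v *)
(* The complement Y of X must be closed under midpoints of pairs of points at
   distance 2a for a in A, while for each b >= 0 outside A it must contain some
   x, x + 2b but not x + b.  Enumerate all pairs (F_t, b_t) of an uncountable
   closed set and a real number along a well-order of 2^N whose proper initial
   segments have fewer than continuum many elements.  As F_t contains a copy of
   2^N, one can choose x_t in F_t outside the Q-span K_t of the x_s (s < t) and
   the b_s (s <= t).  Let Y consist of the points w x_t + k with b_t >= 0, k in
   K_t, w rational, 0 < w <= 1, where for w = 1 only x_t and x_t + 2 b_t are
   admitted unless b_t is in A.  Taking a midpoint either halves the leading
   weight w or averages two weights at the same t, so Y has the required
   closure; and by genericity Y contains neither x_t for b_t < 0, nor x_t + b_t
   for b_t >= 0 outside A.  The sign of b_t thus decides whether x_t makes X or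
   its complement meet F_t. *)
Require Import Defs.
From mathcomp Require Import all_boot all_order all_algebra.
From mathcomp Require Import wochoice all_classical all_reals all_analysis.
From mathcomp Require Import ring lra.
Import Order.TTheory GRing.Theory Num.Theory numFieldNormedType.Exports.
Local Open Scope classical_set_scope.
Local Open Scope ring_scope.

Set Implicit Arguments.
Unset Strict Implicit.
Unset Printing Implicit Defensive.

Local Open Scope card_scope.

(** * Comparison of cardinals *)

Lemma card_leTP (T U : Type) :
  [set: T] #<= [set: U] <-> exists f : T -> U, injective f.
Proof.
split=> [/card_leP/injfunPex[f _ fI]|[f fI]].
  exists (fun x => val (f (SigSub (mem_set (I : [set: T] x))))) => x y.
  move=> /val_inj e.
  have := fI _ _ (mem_set I) (mem_set I) e.
  by move=> /(congr1 val).
apply/card_leP/injfunPex.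
exists (fun x => SigSub (mem_set (I : [set: U] (f (val x))))) => // x y _ _.
by move=> /(congr1 val)/= /fI/val_inj.
Qed.

Lemma card_le_rel (T U : Type) (A : set T) (B : set U) (G : T -> U -> Prop) :
  (forall a, A a -> exists2 b, B b & G a b) ->
  (forall a a' b, G a b -> G a' b -> a = a') -> A #<= B.
Proof.
move=> AB GI; rewrite -(card_le_eql (card_setT A)) -(card_le_eqr (card_setT B)).
apply/card_leTP.
pose f (a : A) := cid2 (AB (val a) (set_valP a)).
exists (fun a => SigSub (mem_set (s2valP (f a)))) => a a' /(congr1 val)/= e.
apply: val_inj; apply: GI (s2valP' (f a)) _.
by rewrite e; exact: s2valP'.
Qed.

(** Zorn's lemma gives a maximal partial bijection [G] between [A] and [B]; it is total on one side,
    since otherwise an unmatched pair [(a, b)] could be added. *)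
Lemma card_le_total (T U : Type) (A : set T) (B : set U) : A #<= B \/ B #<= A.
Proof.
pose P (G : set (T * U)) := G `<=` A `*` B /\
  forall p q, G p -> G q -> p.1 = q.1 <-> p.2 = q.2.
have [F FP Ftot|G [[GAB GI] Gmax]] := @Zorn_bigcup _ P.
  split=> [p [G /FP[+ _]]|p q [G FG Gp] [H FH Hq]]; first exact.
  have [GH|HG] := Ftot _ _ FG FH.
    by apply: (FP _ FH).2 => //; exact: GH.
  by apply: (FP _ FG).2 => //; exact: HG.
have [GA|/existsNP[a /not_implyP[Aa Ga]]] :=
    pselect (forall a, A a -> exists2 b, B b & G (a, b)).
  left; apply: (card_le_rel GA) => x y z Gxz Gyz.
  exact: (GI _ _ Gxz Gyz).2.
have [GB|/existsNP[b /not_implyP[Bb Gb]]] :=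
    pselect (forall b, B b -> exists2 a, A a & G (a, b)).
  right; apply: (card_le_rel (G := fun b a => G (a, b)) GB) => x y z Gxz Gyz.
  exact: (GI _ _ Gxz Gyz).1.
have na p : G p -> p.1 <> a.
  case: p => a' b' Gp /= e; apply: Ga; exists b'; first exact: (GAB _ Gp).2.
  by rewrite -e.
have nb p : G p -> p.2 <> b.
  case: p => a' b' Gp /= e; apply: Gb; exists a'; first exact: (GAB _ Gp).1.
  by rewrite -e.
exfalso; apply: (Gmax (G `|` [set (a, b)])); first split.
- by left.
- by move=> /(_ (a, b) (or_intror erefl))/na; exact.
split=> [p [/GAB//|->//]|p q [Gp|->] [Gq|->]]; first exact: GI.
- by split=> [/na|/nb]; case.
- by split=> /esym => [/na|/nb]; case.
- by [].
Qed.

Lemma card_le_fun (T U : Type) (u : U) (A : set T) (B : set U) : A #<= B ->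
  exists2 g : T -> U, (forall x, A x -> B (g x)) & {in A &, injective g}.
Proof.
move=> /card_leP/injfunPex[f _ fI].
pose g x := if pselect (A x) is left Ax then val (f (SigSub (mem_set Ax))) else u.
exists g => [x Ax|x y /set_mem Ax /set_mem Ay]; rewrite /g.
  by case: pselect => // ?; exact: set_valP.
case: pselect => // ?; case: pselect => // ? /val_inj /fI.
by move=> /(_ (mem_set I) (mem_set I)) /(congr1 val).
Qed.

(** * Injective coding of finite sequences over an infinite type *)

Definition seq_coding (T : Type) (A : set T) (f : seq T -> T) :=
  (forall s, all (mem A) s -> A (f s)) /\
  {in [pred s | all (mem A) s] &, injective f}.

Lemma map_inj_on (T U : Type) (A : set T) (g : T -> U) :
  {in A &, injective g} -> {in [pred s | all (mem A) s] &, injective (map g)}.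
Proof.
move=> gI; elim=> [|x s IH] [|y t]//= /andP[Bx Bs] /andP[By Bt] [e].
by move=> /(IH _ Bs Bt) ->; rewrite (gI _ _ Bx By e).
Qed.

Section extend_seq_coding.
Variables (T : Type) (A B : set T) (f : seq T -> T) (g : T -> T).
Hypothesis f_coding : seq_coding A f.
Hypotheses (gA : forall x, B x -> A (g x)) (g_inj : {in B &, injective g}).

(** The lengths 1 and 2 keep the letters of [A] apart from those of [B] outside [A]. *)
Let enc x := if x \in A then f [:: x] else f [:: g x; g x].

Let encA x : (A `|` B) x -> A (enc x).
Proof.
rewrite /enc; case: ifPn => [Ax _|/negP Ax].
  by apply: f_coding.1; rewrite /= Ax.
by case=> [/mem_set//|/gA/mem_set gAx]; apply: f_coding.1; rewrite /= gAx.
Qed.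

Let enc_inj : {in A `|` B &, injective enc}.
Proof.
have gB x : (A `|` B) x -> x \notin A -> B x /\ g x \in A.
  by move=> [/mem_set->//|Bx _]; split=> //; exact/mem_set/gA.
have fI s t : all (mem A) s -> all (mem A) t -> f s = f t -> s = t.
  by move=> As At; exact: f_coding.2.
move=> x y /set_mem ABx /set_mem ABy; rewrite /enc.
case: ifPn => Ax; case: ifPn => Ay.
- by move=> /fI; rewrite /= Ax Ay => /(_ isT isT)[].
- by move=> /fI; rewrite /= Ax (gB _ ABy Ay).2 => /(_ isT isT).
- by move=> /fI; rewrite /= Ay (gB _ ABx Ax).2 => /(_ isT isT).
- move=> /fI; rewrite /= (gB _ ABy Ay).2 (gB _ ABx Ax).2.
  move=> /(_ isT isT)[gxy _]; apply: g_inj gxy; apply: mem_set.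
    exact: (gB _ ABx Ax).1.
  exact: (gB _ ABy Ay).1.
Qed.

Lemma seq_codingU : exists h : seq T -> T,
  (forall s, all (mem (A `|` B)) s -> A (h s)) /\
  {in [pred s | all (mem (A `|` B)) s] &, injective h}.
Proof.
have encs s : all (mem (A `|` B)) s -> all (mem A) (map enc s).
  rewrite all_map; apply: sub_all => x /set_mem ABx; exact/mem_set/encA.
exists (f \o map enc); split=> [s /encs|s t ABs ABt /f_coding.2 e].
  exact: f_coding.1.
by apply: (map_inj_on enc_inj ABs ABt); apply: e; exact: encs.
Qed.

End extend_seq_coding.

(** Zorn's lemma applies to partial codings [(A, f)] ordered by extension, starting from a copy of
    the natural numbers. This replaces cardinal arithmetic for infinite cardinals. *)
Lemma infinite_seq_coding (T : Type) : infinite_set [set: T] ->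
  exists f : seq T -> T, injective f.
Proof.
elim/Pchoice: T => T /infiniteP/card_leTP[u uI].
pose D := {p : set T * (seq T -> T) | seq_coding p.1 p.2}.
pose le (p q : D) := (sval p).1 `<=` (sval q).1 /\
  {in [pred s | all (mem (sval p).1) s], (sval p).2 =1 (sval q).2}.
have le_refl p : le p p by split.
have sub_allA (A B : set T) s : A `<=` B -> all (mem A) s -> all (mem B) s.
  by move=> AB; apply: sub_all => x /set_mem/AB/mem_set.
have le_trans p q r : le p q -> le q r -> le p r.
  move=> [pq1 pq2] [qr1 qr2]; split; first exact: subset_trans qr1.
  by move=> s ps; rewrite pq2// qr2// inE; exact: sub_allA ps.
pose v x := xget 0%N [set n | u n = x].
have uK x : range u x -> u (v x) = x.
  by move=> [n _ nx]; rewrite /v; case: xgetP => // /(_ n).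
have cod0 : seq_coding (range u) (u \o choice.pickle \o map v).
  split=> [s _|s t us ut /uI/(pcan_inj choice.pickleK)]; first by eexists.
  apply: (map_inj_on _ us ut) => x y /set_mem/uK + /set_mem/uK.
  by move=> {2}<- {2}<- ->.
pose ple p q := `[< le p q >].
have bounded F : total_on F ple -> exists r, forall p, F p -> ple p r.
  move=> Ftot.
  have {}Ftot p q : F p -> F q -> exists2 r, F r & le p r /\ le q r.
    move=> Fp Fq; have [/asboolP ?|/asboolP ?] := Ftot _ _ Fp Fq.
      by exists q.
    by exists p.
  have [->|/set0P[p0 Fp0]] := eqVneq F set0.
    by exists (exist _ (_, _) cod0) => p.
  pose U := \bigcup_(p in F) (sval p).1.
  (* A finite sequence over the union of a chain lies over a single member, and members agree where
     both are defined; [u 0] is only a default. *)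
  pose f s := xget (u 0%N)
    [set y | exists p, [/\ F p, all (mem (sval p).1) s & y = (sval p).2 s]].
  have fE p s : F p -> all (mem (sval p).1) s -> f s = (sval p).2 s.
    move=> Fp ps; rewrite /f; case: xgetP => [y _ [q [Fq qs ->]]|/(_ ((sval p).2 s))].
      have [r _ [[_ pr] [_ qr]]] := Ftot _ _ Fp Fq.
      by rewrite pr// qr.
    by case; exists p.
  have allU s : all (mem U) s -> exists2 p, F p & all (mem (sval p).1) s.
    elim: s => [_|x s IH /= /andP[/set_mem[p Fp px] /IH[q Fq qs]]].
      by exists p0.
    have [r Fr [[pr _] [qr _]]] := Ftot _ _ Fp Fq.
    exists r => //; rewrite (mem_set (pr _ px)).
    exact: sub_allA qs.
  have Uf : seq_coding U f.
    split=> [s /allU[p Fp ps]|s t /allU[p Fp ps] /allU[q Fq qt]].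
      by rewrite (fE _ _ Fp ps); exists p => //; exact: (svalP p).1.
    have [r Fr [[pr _] [qr _]]] := Ftot _ _ Fp Fq.
    have rs := sub_allA _ _ _ pr ps; have rt := sub_allA _ _ _ qr qt.
    by rewrite (fE _ _ Fr rs) (fE _ _ Fr rt); exact: (svalP r).2.
  exists (exist _ (U, f) Uf) => p Fp; apply/asboolP.
  split=> [x px|s ps] /=; first by exists p.
  by rewrite (fE p).
have ple_trans p q r : ple p q -> ple q r -> ple p r.
  by move=> /asboolP pq /asboolP qr; apply/asboolP; exact: le_trans qr.
have [[[A f] /= fA] Amax] := @ZL_preorder D (exist _ (_, _) cod0) ple
  (fun p => asboolT (le_refl p)) ple_trans bounded.
(* By [seq_codingU], a maximal coding either extends to all of [T], when the
   complement of [A] embeds into [A], or to a copy of [A] in that complement. *)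
have [|] := card_le_total (~` A) A => /(card_le_fun (u 0%N))[g gA gI].
  have [h [_ hI]] := seq_codingU fA gA gI.
  have allT s : all (mem (A `|` ~` A)) s.
    by rewrite setUv; apply/allP => x _; exact: mem_set.
  by exists h => s t; exact: (hI s t (allT s) (allT t)).
pose B := g @` A.
pose k x := xget (u 0%N) [set a | A a /\ g a = x].
have kP x : B x -> A (k x) /\ g (k x) = x.
  by move=> [a Aa ax]; rewrite /k; case: xgetP => // /(_ a); case.
have kA x : B x -> A (k x) by move=> /kP[].
have kI : {in B &, injective k}.
  by move=> x y /set_mem/kP[_ {2}<-] /set_mem/kP[_ {2}<-] ->.
have BA : B `<=` ~` A by move=> _ [a Aa <-]; exact: gA.
have [h [hA hI]] := seq_codingU fA kA kI.
(* Sequences over [A] keep their code in [A]; all others get a code in [B], disjoint from [A], so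
   the two kinds cannot collide. *)
pose f' s := if all (mem A) s then f s else g (h s).
have ABf' : seq_coding (A `|` B) f'.
  split=> [s ABs|s t ABs ABt]; rewrite /f'.
    case: ifP => As; first by left; exact: fA.1.
    by right; exists (h s) => //; exact: hA.
  case: ifP => As; case: ifP => At.
  - exact: fA.2.
  - by move=> e; have := gA _ (hA _ ABt); rewrite -e => /(_ (fA.1 _ As)).
  - by move=> e; have := gA _ (hA _ ABs); rewrite e => /(_ (fA.1 _ At)).
  - by move=> /gI e; apply: hI => //; apply: e; exact/mem_set/hA.
have /Amax/asboolP[/= + _] : ple (exist _ (A, f) fA) (exist _ (A `|` B, f') ABf').
  apply/asboolP; split=> /= [x Ax|s As]; first by left.
  by rewrite /f' ifT.
have Anil : A (f [::]) by exact: fA.1.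
move=> /(_ (g (f [::])) (or_intror _)) H.
by exfalso; apply: (gA _ Anil); apply: H; exists (f [::]).
Qed.

(** * Well-orders with small initial segments *)

(** The order type is an initial ordinal. The last clause is what keeps the choice of [x t] possible
    at every stage of the recursion. *)
Lemma minimal_well_order (T : eqType) : exists lt : T -> T -> Prop,
  [/\ well_founded lt, forall s t, [\/ lt s t, s = t | lt t s],
      forall r s t, lt r s -> lt s t -> lt r t &
      forall t, ~ ([set: T] #<= [set s | lt s t])].
Proof.
have [R Rwo] := well_ordering_principle T.
have Rmin (A : set T) : A !=set0 -> exists2 z, A z & forall x, A x -> R z x.
  move=> [x Ax].
  have [|z [[/asboolP Az zA] _]] := Rwo [pred x | `[< A x >]].
    by exists x; exact/asboolP.
  by exists z => // y Ay; apply: zA; exact/asboolP.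
have Rxx x : R x x.
  by have [|y -> ymin] := Rmin [set x]; [exists x|exact: ymin].
have Ranti s t : R s t -> R t s -> s = t.
  move=> st ts; have [|z [_ zu]] := Rwo (pred2 s t).
    by exists s; rewrite inE eqxx.
  rewrite -(zu s); first rewrite -(zu t)//.
    by split=> [|x]; rewrite !inE ?eqxx ?orbT// => /orP[]/eqP->.
  by split=> [|x]; rewrite !inE ?eqxx// => /orP[]/eqP->.
pose lt s t := ~ R t s.
have lt_wf : well_founded lt.
  apply: contrapT => /existsNP/Rmin[z zN zmin]; apply: zN.
  by constructor => y yz; apply: contrapT => /zmin.
have lt_total s t : [\/ lt s t, s = t | lt t s].
  have [ts|/negP ?] := boolP (R t s); last by constructor 1.
  have [st|/negP ?] := boolP (R s t); last by constructor 3.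
  by constructor 2; exact: Ranti.
have lt_trans r s t : lt r s -> lt s t -> lt r t.
  move=> rs st tr.
  have [|z] := Rmin [set x | x = r \/ x = s \/ x = t]; first by exists r; left.
  move=> zrst zmin.
  have [zr zs zt] : [/\ R z r, R z s & R z t].
    by split; apply: zmin; [left|right; left|right; right].
  case: zrst => [zE|[|] zE]; subst z; [|exact: rs|exact: st].
  by have rt := Ranti _ _ zt tr; apply: st; rewrite -rt.
(* Otherwise, transport the order along an embedding of [T] into the least
   initial segment that is as large as [T]. *)
have [|/existsNP/Rmin[t0 /contrapT t0T t0min]] :=
  pselect (forall t, ~ ([set: T] #<= [set s | lt s t])); first by exists lt.
have [h ht0 hI] := card_le_fun t0 t0T.
exists (fun s t => lt (h s) (h t)); split.
- suff acc u s : h s = u -> Acc (fun s t => lt (h s) (h t)) s.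
    by move=> s; exact: acc erefl.
  elim/(well_founded_ind lt_wf): u s => u IH s hs.
  by constructor => r rs; apply: (IH (h r)) => //; rewrite -hs.
- move=> s t; have [?|hst|?] := lt_total (h s) (h t).
  + by constructor 1.
  + by constructor 2; apply: hI => //; exact: mem_set.
  + by constructor 3.
- by move=> r s t; exact: lt_trans.
(* A segment below [t] as large as [T] would make the segment below [h t] as large, against the
   minimality of [t0]. *)
- move=> t /card_le_trans le_t; apply: (ht0 t I).
  apply: t0min => /(_ (le_t _ _ _)); apply.
  apply: (card_le_rel (G := fun s u => u = h s)) => [s st|s s' _ ->].
    by exists (h s).
  by move=> /hI; apply; exact: mem_set.
Qed.

(** * Uncountable closed sets of reals, and codes for closed sets *)

Section perfect_subset.
Variables (R : realType) (F : set R).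
Let uncountable_on (p : R * R) := ~ countable (F `&` `[p.1, p.2]).

Let uncountable_on_split a b : uncountable_on (a, b) -> exists c d,
  [/\ uncountable_on (a, c), uncountable_on (d, b),
      (c < d)%R, (c <= b)%R & (a <= d)%R].
Proof.
move=> Uab.
(* Any two points left after removing the countable pieces cut off at a rational
   are separated by rationals whose outer pieces are both uncountable. *)
pose S (i : bool * rat) : set R :=
  F `&` (if i.1 then `[a, ratr i.2]%classic else `[ratr i.2, b]%classic).
pose C : set R := \bigcup_(i in [set i | countable (S i)]) S i.
have cC : countable C by apply: bigcup_countable.
pose E := (F `&` `[a, b]) `\` C.
have [x [y [[[Fx abx] Cx] [[Fy aby] Cy] xy]]] :
    exists x y, [/\ E x, E y & (x < y)%R].
  apply: contrapT => NE; apply: Uab.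
  have [E0|/set0P[x Ex]] := eqVneq E set0.
    apply: sub_countable cC; apply: subset_card_le => z Fz.
    by apply: contrapT => Cz; have : E z by []; rewrite E0.
  pose C' (i : bool) := if i then C else [set x].
  apply: (@sub_countable _ _ _ (\bigcup_(i in [set: bool]) C' i)); last first.
    by apply: bigcup_countable => [|[] _] //; exact: countable1.
  apply: subset_card_le => z Fz.
  have [Cz|Cz] := pselect (C z); first by exists true.
  exists false => //=; apply: contrapT => zx.
  apply: NE; have [xz|zx'|xz] := ltgtP x z; first by exists x, z.
    by exists z, x.
  by case: zx; rewrite xz.
have /andP[ax xb] : (a <= x <= b)%R by move: abx; rewrite /= in_itv.
have /andP[ay yb] : (a <= y <= b)%R by move: aby; rewrite /= in_itv.
have [q' /[!in_itv]/= /andP[xq' q'y]] := rat_in_itvoo xy.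
have [q /[!in_itv]/= /andP[xq qq']] := rat_in_itvoo xq'.
exists (ratr q), (ratr q'); split=> //.
- move=> cq; apply: Cx; exists (true, q) => //; split=> //=.
  by rewrite in_itv/= ax ltW.
- move=> cq; apply: Cy; exists (false, q') => //; split=> //=.
  by rewrite in_itv/= yb ltW.
- exact: (ltW (lt_le_trans qq' (le_trans (ltW q'y) yb))).
- exact: (le_trans ax (ltW xq')).
Qed.

(** Cantor scheme: a binary sequence selects nested intervals, each meeting [F] in an uncountable
    set; compactness gives a point of [F] in all of them, and the gaps between sibling intervals
    separate distinct branches. *)
Lemma card_le_closed_uncountable : closed F -> ~ countable F ->
  [set: nat -> bool] #<= F.
Proof.
move=> Fclosed Func.
have [p0 Up0] : exists p, uncountable_on p.
  apply: contrapT => /forallNP Fc; apply: Func.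
  apply: (@sub_countable _ _ _
      (\bigcup_(n in [set: nat]) (F `&` `[- n%:R, n%:R]))); last first.
    apply: bigcup_countable => // n _; apply: contrapT.
    exact: (Fc (- n%:R, n%:R)).
  apply: subset_card_le => x Fx; exists (Num.bound `|x|) => //; split=> //=.
  by rewrite in_itv/= -ler_norml ltW// archi_boundP.
have split_ p : { q : R * R | uncountable_on p -> [/\ uncountable_on (p.1, q.1),
    uncountable_on (q.2, p.2), (q.1 < q.2)%R, (q.1 <= p.2)%R & (p.1 <= q.2)%R]}.
  apply/cid; have [Up|NUp] := pselect (uncountable_on p); last by exists p.
  by case: p Up => a b /uncountable_on_split[c [d ?]]; exists (c, d).
pose child (e : bool) (p : R * R) :=
  if e then (p.1, (sval (split_ p)).1) else ((sval (split_ p)).2, p.2).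
pose fix I (w : nat -> bool) n := if n is m.+1 then child (w m) (I w m) else p0.
have UI w n : uncountable_on (I w n).
  elim: n => //= n IH; rewrite /child; case: ifP => _.
    by case: (svalP (split_ _) IH).
  by case: (svalP (split_ _) IH).
pose J w n := F `&` `[(I w n).1, (I w n).2].
have J_closed w n : closed (J w n).
  by apply: closedI => //; exact: interval_closed.
have J_decr w m n : (m <= n)%N -> J w n `<=` J w m.
  move=> /subnK<-; elim: (n - m)%N => // k IH; apply: subset_trans IH.
  move=> x [Fx]; rewrite addSn /= /child.
  have [_ _ _ le1 le2] := svalP (split_ _) (UI w (k + m)%N).
  case: ifP => _ /=; rewrite in_itv/= => /andP[h1 h2]; split=> //=;
    rewrite in_itv/=.
    by rewrite h1 (le_trans h2).
  by rewrite h2 (le_trans le2).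
apply: (card_le_rel (G := fun w x => forall n, J w n x)) => [w _|w w' x wx w'x].
  have /choice[u uJ] n : exists x, J w n x.
    apply/set0P/negP => /eqP J0; apply: (UI w n).
    by rewrite /uncountable_on -/(J w n) J0.
  have [x [_ xu]] : `[p0.1, p0.2] `&` cluster (u @ \oo) !=set0.
    apply: (@segment_compact _ p0.1 p0.2).
    by exists 0%N => // n _; have [] := J_decr _ _ _ (leq0n n) _ (uJ n).
  have Jx n : J w n x.
    apply: J_closed => B; apply: xu.
    by exists n => // m nm; exact: J_decr (uJ m).
  by exists x => //; have [] := Jx 0%N.
apply/funext => n.
(* Equality of the intervals is carried along: only children of the same interval are known to be
   disjoint. *)
suff : w n = w' n /\ I w n = I w' n by case.
elim/ltn_ind: n => n IH.
have eI : I w n = I w' n.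
  by case: n IH => //= n /(_ n (ltnSn n))[-> ->].
split=> //.
have [_ _ lt12 _ _] := svalP (split_ _) (UI w' n).
have [_] := wx n.+1; have [_] := w'x n.+1; rewrite /= eI !in_itv/= /child.
case: (w n); case: (w' n) => //= /andP[h1 h2] /andP[h3 h4].
  by have := le_lt_trans (le_trans h1 h4) lt12; rewrite ltxx.
by have := le_lt_trans (le_trans h3 h2) lt12; rewrite ltxx.
Qed.

End perfect_subset.

(** A closed set is determined by the rational intervals that miss it, and a real by the rationals
    below it. *)
Lemma closed_real_codes (R : realType) :
  [set p : set R * R | closed p.1] #<= [set: nat -> bool].
Proof.
have [pk [upk pkK]] : exists (pk : rat * rat + rat -> nat) upk, pcancel pk upk.
  by exists choice.pickle, choice.unpickle; exact: choice.pickleK.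
pose code (p : set R * R) n : bool :=
  match upk n with
  | Some (inl (q, r)) => `[< p.1 `&` `]ratr q, ratr r[ = set0 >]
  | Some (inr q) => (ratr q < p.2)%R
  | None => false
  end.
apply: (card_le_rel (G := fun p w => closed p.1 /\ w = code p)) => [p Fp|].
  by exists (code p).
have sub1 (q r : set R * R) : closed r.1 -> code q = code r -> q.1 `<=` r.1.
  move=> Fr qr x qx; apply: contrapT => rx.
  have : open (~` r.1) by exact: closed_openC.
  rewrite openE => /(_ x rx)[e/= e0 xe].
  have [s /[!in_itv]/= /andP[es sx]] : exists s : rat, ratr s \in `](x - e)%R, x[.
    by apply: rat_in_itvoo; rewrite ltrBlDr ltrDl.
  have [t /[!in_itv]/= /andP[xt te]] : exists s : rat, ratr s \in `]x, (x + e)%R[.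
    by apply: rat_in_itvoo; rewrite ltrDl.
  have := congr1 (fun w => w (pk (inl (s, t)))) qr.
  rewrite /code pkK (_ : `[< r.1 `&` _ = _ >] = true).
    move=> /asboolP q0; suff : (q.1 `&` `]ratr s, ratr t[) x by rewrite q0.
    by split => //; rewrite /= in_itv/= sx.
  apply/asboolP; rewrite -subset0 => y [ry] /=; rewrite in_itv/= => /andP[sy yt].
  apply: (xe y) ry; rewrite /ball/= distrC ltr_distl.
  by rewrite (lt_trans es)//= (lt_trans yt).
have le2 (q r : set R * R) : code q = code r -> (q.2 <= r.2)%R.
  move=> qr; rewrite leNgt; apply/negP => /rat_in_itvoo[s /[!in_itv]/= /andP[rs sq]].
  have := congr1 (fun w => w (pk (inr s))) qr.
  by rewrite /code pkK sq ltNge (ltW rs).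
move=> [F b] [F' b'] _ [Fc ->] [Fc' e]; congr pair.
  by apply/seteqP; split; [exact: (sub1 _ _ Fc' e)|exact: (sub1 _ _ Fc (esym e))].
by apply/eqP; rewrite eq_le (le2 _ _ e) (le2 _ _ (esym e)).
Qed.

(** * Rational spans and their cardinality *)

Definition rat_span (R : realType) (D : set R) : set R :=
  [set x | exists2 s : seq (rat * R), (forall p, p \in s -> D p.2) &
    x = (\sum_(p <- s) ratr p.1 * p.2)%R].

Section rat_span.
Variable R : realType.
Implicit Types D : set R.

Lemma sub_rat_span D : D `<=` rat_span D.
Proof.
move=> x Dx; exists [:: (1%R, x)] => [p|]; first by rewrite inE => /eqP->.
by rewrite big_seq1 rmorph1 mul1r.
Qed.

Lemma rat_span0 D : rat_span D 0.
Proof. by exists [::] => //; rewrite big_nil. Qed.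

Lemma rat_spanD D x y : rat_span D x -> rat_span D y -> rat_span D (x + y).
Proof.
move=> [s sD ->] [t tD ->]; exists (s ++ t) => [p|]; last by rewrite big_cat.
by rewrite mem_cat => /orP[/sD|/tD].
Qed.

Lemma rat_spanZ D q x : rat_span D x -> rat_span D (ratr q * x).
Proof.
move=> [s sD ->]; exists [seq (q * p.1, p.2) | p <- s]%R.
  by move=> _ /mapP[p /sD ? ->].
by rewrite big_map mulr_sumr; apply: eq_bigr => p _; rewrite rmorphM mulrA.
Qed.

Lemma rat_spanB D x y : rat_span D x -> rat_span D y -> rat_span D (x - y).
Proof.
move=> Dx Dy; apply: rat_spanD => //.
by rewrite -mulN1r -(rmorph1 (@ratr R)) -rmorphN; exact: rat_spanZ.
Qed.

Lemma rat_span_sub D D' : D `<=` rat_span D' -> rat_span D `<=` rat_span D'.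
Proof.
move=> DD' _ [s sD ->]; rewrite big_seq.
elim/big_rec: _ => [|p x /sD/DD' Dp Dx]; first exact: rat_span0.
by apply: rat_spanD => //; exact: rat_spanZ.
Qed.

(* When [T] is infinite, a term [(q, (c, o))] of a linear combination is coded by
   a constant sequence whose length records [(q, c, isSome o)]. *)
Lemma rat_span_card (C : countType) (T U : Type) (g : C * option T -> R) D :
  D `<=` range g -> ~ countable [set: U] ->
  [set: U] #<= rat_span D -> [set: U] #<= [set: T].
Proof.
move=> Dg Uunc Uspan.
pose S := seq (rat * (C * option T)).
have {Uspan} US : [set: U] #<= [set: S].
  apply: card_le_trans Uspan _.
  apply: (card_le_rel
    (G := fun x (s : S) => x = (\sum_(p <- s) ratr p.1 * g p.2)%R)); last first.
    by move=> x y s -> ->.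
  move=> _ [s sD ->]; elim: s sD => [|p s IH] sD.
    by exists [::]; rewrite ?big_nil.
  have [|t _ e] := IH; first by move=> ? ps; apply: sD; rewrite inE ps orbT.
  have [|c _ cp] := Dg p.2; first by apply: sD; exact: mem_head.
  by exists ((p.1, c) :: t); rewrite // !big_cons e cp.
(* For finite [T] there are only countably many combinations, too few for [U]. *)
have [Tfin|Tinf] := pselect (finite_set [set: T]).
  have [T' TT'] := Pcountable (finite_set_countable Tfin); subst T.
  by exfalso; apply: Uunc; apply: sub_countable US _; exact: countableP.
apply: card_le_trans US _; apply/card_leTP.
have [f fI] := infinite_seq_coding Tinf; pose t0 := f [::].
have [pk pkI] : exists pk : rat * C * bool -> nat, injective pk.
  by exists choice.pickle; exact: pcan_inj choice.pickleK.
pose enc (p : rat * (C * option T)) : seq T :=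
  (* The successor keeps the sequence nonempty, so that its head still gives the element of [T]. *)
  nseq (pk (p.1, p.2.1, isSome p.2.2)).+1 (odflt t0 p.2.2).
have enc_inj : injective enc.
  move=> [q [c o]] [q' [c' o']]; rewrite /enc/= => e.
  have := congr1 size e; rewrite /= !size_nseq => -[].
  move=> /pkI[-> -> oo'].
  case: e => + _; case: o oo' => [a|]; case: o' => [a'|] //= _.
  by move=> ->.
exists (f \o map (f \o enc)).
by apply: inj_comp => //; exact/inj_map/inj_comp.
Qed.

End rat_span.

(** Transfinite recursion with a choice at each stage. The first condition on [P] says that it sees
    only the values below [t], so the history may be completed by the dummy [u0]. *)
Lemma well_founded_choice (T : Type) (U : choiceType) (u0 : U)
    (lt : T -> T -> Prop) (P : T -> (T -> U) -> U -> Prop) :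
  well_founded lt ->
  (forall t f g u, (forall s, lt s t -> f s = g s) -> P t f u -> P t g u) ->
  (forall t f, exists u, P t f u) -> exists f, forall t, P t f (f t).
Proof.
move=> lt_wf P_local P_ex.
pose ext t (r : forall s, lt s t -> U) s :=
  if pselect (lt s t) is left st then r s st else u0.
pose step t r := xget u0 [set u | P t (ext t r) u].
pose f := Fix lt_wf (fun _ => U) step.
have fE t : f t = step t (fun s _ => f s).
  apply: (Fix_eq lt_wf (fun _ => U) step) => s r r' rr'; congr step.
  by apply/functional_extensionality_dep => u; apply/funext => us; exact: rr'.
exists f => t; apply: (P_local t (ext t (fun s _ => f s))).
  by move=> s st; rewrite /ext; case: pselect.
rewrite fE /step; case: xgetP => // noP.
by have [u /noP] := P_ex t (ext t (fun s _ => f s)).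
Qed.

(** Cantor's diagonal: [d] differs at [n] from the sequence with code [n]. *)
Lemma uncountable_nat_bool : ~ countable [set: nat -> bool].
Proof.
move=> /card_leTP[f fI].
pose d n := ~~ xget (fun _ => false) [set w | f w = n] n.
have dE : xget (fun _ => false) [set w | f w = f d] = d.
  by case: xgetP => [w _ /fI//|/(_ d)]; case.
have : d (f d) = ~~ d (f d) by rewrite {1}/d dE.
by case: (d (f d)).
Qed.

(** * Generic points and the midpoint-closed set *)

Section generic_points.
Local Open Scope ring_scope.
Variables (R : realType) (T : Type) (lt : T -> T -> Prop) (b : T -> R).

Definition prior_span (x : T -> R) (t : T) : set R :=
  rat_span ([set x s | s in [set s | lt s t]] `|`
            [set b s | s in [set s | lt s t \/ s = t]]).

Lemma card_le_prior_span (U : Type) x t : ~ countable [set: U] ->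
  [set: U] #<= prior_span x t -> [set: U] #<= [set s | lt s t].
Proof.
move=> Uunc Ux; rewrite -(card_le_eqr (card_setT _)).
(* The boolean selects [x] or [b] at an earlier index; [None] stands for the extra generator
   [b t]. *)
pose g (p : bool * option [set s | lt s t]) :=
  if p.2 is Some s then if p.1 then x (val s) else b (val s) else b t.
pose I s (st : lt s t) : [set s | lt s t] := SigSub (mem_set st).
apply: (rat_span_card (g := g) _ Uunc Ux) => _ [[s st <-]|[s [st|->] <-]].
- by exists (true, Some (I s st)).
- by exists (false, Some (I s st)).
- by exists (true, None).
Qed.

Hypothesis lt_total : forall s t, [\/ lt s t, s = t | lt t s].
Hypothesis lt_trans : forall r s t, lt r s -> lt s t -> lt r t.
Variable x : T -> R.
Hypothesis x_generic : forall t, ~ prior_span x t (x t).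
Local Notation K := (prior_span x).

Let K_lt s t : lt s t -> K s `<=` K t.
Proof.
move=> st; apply: rat_span_sub => y sy; apply: sub_rat_span.
case: sy => -[r rs <-]; [left|right]; exists r => //; first exact: lt_trans st.
by left; case: rs => [/lt_trans|->]; first exact.
Qed.

Let x_K s t : lt s t -> K t (x s).
Proof. by move=> st; apply: sub_rat_span; left; exists s. Qed.

Let b_K t : K t (b t).
Proof. by apply: sub_rat_span; right; exists t => //; right. Qed.

(** In any other case the equation can be solved for the point of the later index, or for [x t] with
    coefficient [1 - w] when the indices agree, which puts that point in its own prior span. *)
Lemma generic_decomposition s t (w : rat) k c : 0 < w -> K t k -> K s c ->
  ratr w * x t + k = x s + c -> [/\ t = s, w = 1 & k = c].
Proof.
move=> w0 tk sc e; have [ts|ts|st] := lt_total t s.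
- exfalso; apply: (@x_generic s).
  rewrite (_ : x s = ratr w * x t + k - c); last by rewrite e addrK.
  apply: rat_spanB => //; apply: rat_spanD; last exact: K_lt tk.
  by apply: rat_spanZ; exact: x_K.
- subst s; have [w1|w1] := eqVneq w 1.
    by split=> //; move: e; rewrite w1 rmorph1 mul1r => /addrI.
  exfalso; apply: (@x_generic t).
  rewrite (_ : x t = ratr (1 - w)^-1 * (k - c)).
    by apply: rat_spanZ; exact: rat_spanB.
  have w1' : ratr (1 - w) != 0 :> R by rewrite fmorph_eq0 subr_eq0 eq_sym.
  apply: (mulfI w1'); rewrite mulrA fmorphV divff// mul1r rmorphB rmorph1.
  by rewrite mulrBl mul1r; apply/eqP; rewrite subr_eq addrAC -subr_eq opprK addrC e addrC.
- exfalso; apply: (@x_generic t).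
  rewrite (_ : x t = ratr w^-1 * (x s + c - k)).
    apply: rat_spanZ; apply: rat_spanB => //; apply: rat_spanD.
      exact: x_K.
    exact: K_lt sc.
  rewrite -e addrK mulrA fmorphV mulVf ?mul1r// fmorph_eq0.
  by rewrite gt_eqF.
Qed.

Variable A : set R.

Definition midpoint_hull : set R := [set u | exists t (w : rat) k,
  [/\ 0 <= b t, 0 < w <= 1, K t k, u = ratr w * x t + k &
      w = 1 -> [\/ u = x t, u = x t + 2 * b t | A (b t)]]].
Local Notation Y := midpoint_hull.

Lemma midpoint_hull_x t : 0 <= b t -> Y (x t).
Proof.
move=> bt; exists t, 1, 0; split=> //; first exact: rat_span0.
  by rewrite rmorph1 mul1r addr0.
by move=> _; constructor 1.
Qed.

Lemma midpoint_hull_xD t : 0 <= b t -> Y (x t + 2 * b t).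
Proof.
move=> bt; exists t, 1, (2 * b t); split=> //.
- by rewrite -(ratr_nat R 2); apply: rat_spanZ; exact: b_K.
- by rewrite rmorph1 mul1r.
- by move=> _; constructor 2.
Qed.

Lemma midpoint_hull_neg t : b t < 0 -> ~ Y (x t).
Proof.
move=> bt [s [w [k [bs /andP[w0 _] sk e _]]]].
have [|st _ _] := @generic_decomposition t s w k 0 w0 sk (rat_span0 _).
  by rewrite addr0.
by move: bs; rewrite st leNgt bt.
Qed.

Lemma midpoint_hull_xDb t : 0 < b t -> ~ A (b t) -> ~ Y (x t + b t).
Proof.
move=> bt0 Abt [s [w [k [_ /andP[w0 _] sk e wA]]]].
have [st w1 _] := generic_decomposition w0 sk (b_K t) (esym e).
by subst s; case: (wA w1) => // h; lra.
Qed.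

Lemma midpoint_hull_mid u v : Y u -> Y v -> A (`|u - v| / 2) -> Y ((u + v) / 2).
Proof.
(* The point of smaller index lies in [K t], so the midpoint has weight [w / 2] at [t]; this is less
   than 1, so the last condition is vacuous. *)
have mix s t : lt s t -> forall u v, (exists (w : rat) k, K s k /\ u = ratr w * x s + k) ->
    0 <= b t -> forall (w : rat) k, 0 < w <= 1 -> K t k -> v = ratr w * x t + k ->
    Y ((u + v) / 2).
  move=> st {}u {}v [w' [k' [sk' ->]]] bt w k /andP[w0 w1] tk ->.
  exists t, (w / 2), (2^-1 * (ratr w' * x s + k' + k)); split=> //.
  - by lra.
  - rewrite -(ratr_nat R 2) -fmorphV; apply: rat_spanZ; apply: rat_spanD => //.
    apply: rat_spanD; last exact: K_lt sk'.
    by apply: rat_spanZ; exact: x_K.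
  - by rewrite fmorph_div/= ratr_nat; field.
  - by lra.
move=> [s [w [k [bs w01 sk uE wA]]]] [t [w' [k' [bt w01' tk' vE wA']]]] Auv.
have [st|st|ts] := lt_total s t.
- by apply: (mix s t st _ _ _ bt w' k') => //; exists w, k.
- subst t; exists s, ((w + w') / 2), (2^-1 * (k + k')); split=> //.
  + by lra.
  + by rewrite -(ratr_nat R 2) -fmorphV; apply: rat_spanZ; exact: rat_spanD.
  + by rewrite uE vE fmorph_div rmorphD/= ratr_nat; field.
  (* Average weight 1 forces both weights to be 1. If the two points are [x s] and [x s + 2 * b s],
     half their distance is [b s], hence in [A]. *)
  + move=> ww1; have [w1 w1'] : w = 1 /\ w' = 1 by lra.
    have {}wA := wA w1; have {}wA' := wA' w1'.
    have xb : `|2 * b s| / 2 = b s by rewrite ger0_norm ?mulr_ge0// mulrC mulKf.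
    case: wA => [us|us|]; last by constructor 3.
      case: wA' => [vs|vs|]; last by constructor 3.
        by constructor 1; rewrite us vs; lra.
      constructor 3; move: Auv; rewrite us vs opprD addrA subrr sub0r normrN.
      by rewrite xb.
    case: wA' => [vs|vs|]; last by constructor 3.
      by constructor 3; move: Auv; rewrite us vs addrAC subrr add0r xb.
    by constructor 2; rewrite us vs; lra.
- by rewrite addrC; apply: (mix t s ts _ _ _ bs w k) => //; exists w', k'.
Qed.

End generic_points.

(** * Enumeration of the pairs and construction of the Bernstein set *)

Lemma uncountable_real (R : realType) : ~ countable [set: R].
Proof.
move=> cR; have /countable_lebesgue_measure0/eqP : countable (`[0%R, 1%R] : set R).
  exact: sub_countable (subset_card_le (@subsetT _ _)) cR.
by rewrite lebesgue_measure_itv/= lte01 oppr0 adde0 onee_eq0.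
Qed.

Lemma closed_uncountable_codes (R : realType) :
  exists f : (nat -> bool) -> set R * R,
    [set p | closed p.1 /\ ~ countable p.1] = range f.
Proof.
apply/surjfunPex; have : [set p : set R * R | closed p.1 /\ ~ countable p.1] #<=
    [set: nat -> bool].
  apply: card_le_trans (closed_real_codes R).
  by apply: subset_card_le => p [].
(* A surjection exists unless the target is empty, which the pair of the whole line and 0
   excludes. *)
move=> /pfcard_geP[p0|//]; exfalso.
have : [set p : set R * R | closed p.1 /\ ~ countable p.1] (setT, 0%R).
  by split; [exact: closedT|exact: uncountable_real].
by rewrite p0.
Qed.

Local Close Scope card_scope.

Theorem theorem4 (R : realType) (A : set R)
    (A_ge0 : A `<=` [set a | 0 <= a]) (A_0 : A 0) :
  exists X : set R, bernstein_set X /\ center_of_distances (T := R^o) X = A.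
Proof.
have [f fE] := closed_uncountable_codes R.
have f_ok t : closed (f t).1 /\ ~ countable (f t).1.
  by have : range f (f t) by []; rewrite -fE.
have f_onto F a : closed F -> ~ countable F -> exists t, f t = (F, a).
  move=> Fc Func; have : [set p | closed p.1 /\ ~ countable p.1] (F, a) by [].
  by rewrite fE => -[t _ <-]; exists t.
pose b t := (f t).2.
have [lt [lt_wf lt_total lt_trans lt_small]] := minimal_well_order (nat -> bool).
have [||x xP] := @well_founded_choice _ R 0 lt
    (fun t x u => (f t).1 u /\ ~ prior_span lt b x t u) lt_wf.
- move=> t x y u xy; rewrite /prior_span (_ : [set x s | s in _] =
    [set y s | s in [set s | lt s t]])//.
  by apply: eq_imagel.
(* If no choice were left, the closed set would lie in the span, and the binary sequences would
   embed into the segment below [t]. *)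
- move=> t x; apply: contrapT => NE; apply: (lt_small t).
  apply: (card_le_prior_span uncountable_nat_bool (b := b) (x := x)).
  have [Fc Func] := f_ok t.
  apply: card_le_trans (card_le_closed_uncountable Fc Func) _.
  apply: subset_card_le => u Fu; apply: contrapT => xu.
  by apply: NE; exists u.
have x_gen t := (xP t).2.
pose Y := midpoint_hull lt b x A.
have Yx t : 0 <= b t -> Y (x t) by exact: midpoint_hull_x.
exists (~` Y); split=> [F Fc Func|].
  split.
    (* Any negative second component puts [x t] outside [Y]; 0 serves below for the other half. *)
    have [t ft] := f_onto F (-1) Fc Func; exists (x t); split.
      by apply: midpoint_hull_neg => //; rewrite /b ft/=; lra.
    by have := (xP t).1; rewrite ft.
  have [t ft] := f_onto F 0 Fc Func; exists (x t); split.
    by move=> /(_ (Yx t _)); apply; rewrite /b ft.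
  by have := (xP t).1; rewrite ft.
rewrite center_of_distances_realE; apply/seteqP; split=> [a [a0 aX]|a Aa].
  apply: contrapT => NAa.
  have a_gt0 : 0 < a.
    by rewrite lt_neqAle a0 andbT; apply: contra_notN NAa => /eqP <-.
  have [t ft] : exists t, f t = (setT, a).
    by apply: f_onto; [exact: closedT|exact: uncountable_real].
  have bt : b t = a by rewrite /b ft.
  (* The point [x t + a] is in the complement of [Y], but the only points at distance [a] from it,
     [x t] and [x t + 2 * b t], are both in [Y]. *)
  have [|y Yy xy] := aX (x t + a).
    by rewrite -bt; apply: midpoint_hull_xDb => //; rewrite bt.
  have [y1|y2] : y = x t \/ y = x t + 2 * b t.
    have [xay|xay] := lerP 0 (x t + a - y); rewrite bt.
      by left; rewrite ger0_norm// in xy; lra.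
    by right; rewrite ltr0_norm// in xy; lra.
    by apply: Yy; rewrite y1; apply: Yx; rewrite bt.
  by apply: Yy; rewrite y2; apply: midpoint_hull_xD; rewrite bt.
have a0 := A_ge0 _ Aa; split=> // u Yu; apply: contrapT => NE; apply: Yu.
have NX y : `|u - y| = a -> Y y.
  by move=> uy; apply: contrapT => NYy; apply: NE; exists y.
(* Without a partner for [u], both [u + a] and [u - a] are in [Y]; half their distance is [a], so
   their midpoint [u] would be in [Y] too. *)
rewrite (_ : u = ((u + a) + (u - a)) / 2); last by lra.
apply: midpoint_hull_mid => //.
- by apply: NX; rewrite opprD addNKr normrN ger0_norm.
- by apply: NX; rewrite subKr ger0_norm.
- by rewrite (_ : u + a - (u - a) = a * 2) ?normrM ?(ger0_norm a0) ?ger0_norm ?mulfK//; lra.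
Qed.
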